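(* Let $n$, $m$, $q$ be positive integers with $m<n$ and $q<n/m$. Let $f(0),f(1),\dots,f(q)$ be positive real numbers such that either $f(0)>f(1)>\cdots>f(q)$, or there is an integer $s$ with $0\le s<q$ such that $f(0)>f(1)>\cdots>f(s)>0$ and $f(s)=f(s+1)=\cdots=f(q)$. Let $\lambda_1,\dots,\lambda_n$ be arbitrary nonzero complex numbers (not necessarily distinct). Then there exist a matrix $A\in\mathbb{C}^{n\times n}$ whose eigenvalues, counted with algebraic multiplicity, are $\lambda_1,\dots,\lambda_n$, and a vector $r_0\in\mathbb{C}^n$ with $\|r_0\|=f(0)$, such that $\|r_k\|=f(k)$ for $k=1,\dots,q$, where $r_k$ is the residual at cycle $k$ of restarted GMRES with restart parameter $m$ applied to the linear system $Ax=b$ with initial residual $r_0=b-Ax_0$.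
   Context: $\|\cdot\|$ is the Euclidean norm on $\mathbb{C}^n$. For $A\in\mathbb{C}^{n\times n}$, $r\in\mathbb{C}^n$ and $j\ge 1$, the Krylov subspace is $\mathcal{K}_j(A,r)=\mathrm{span}\{r,Ar,\dots,A^{j-1}r\}$, and $A\mathcal{K}_j(A,r)=\mathrm{span}\{Ar,A^2r,\dots,A^jr\}$. Restarted GMRES with restart parameter $m$, GMRES($m$), applied to $Ax=b$ with initial approximation $x_0$ and initial residual $r_0=b-Ax_0$, produces at cycle $k=1,2,\dots$ an approximation $x_k\in x_{k-1}+\mathcal{K}_m(A,r_{k-1})$ whose residual $r_k=b-Ax_k$ has minimal norm; equivalently, $r_k=r_{k-1}-u_k$ where $u_k\in A\mathcal{K}_m(A,r_{k-1})$ and $\|r_k\|=\min_{u\in A\mathcal{K}_m(A,r_{k-1})}\|r_{k-1}-u\|$ (so $r_k$ is uniquely determined by $A$, $m$ and $r_{k-1}$). *)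

(* Defs.v *)
From HB Require Import structures.
From mathcomp Require Import all_boot all_order all_algebra.
From mathcomp Require Import complex reals.

Set Implicit Arguments.
Unset Strict Implicit.
Unset Printing Implicit Defensive.

Import Order.TTheory GRing.Theory Num.Theory.

Local Open Scope ring_scope.

(* The Euclidean norm, real-valued: on R[i] the generic norm `|z| is itself an
   element of R[i], and the library norm on matrices is the sup norm. *)
Definition enorm (R : realType) (n : nat) (v : 'cV[R[i]]_n) : R :=
  Num.sqrt (\sum_(i < n) (complex.Re `|v i ord0|) ^+ 2).

Definition krylov (R : realType) (n : nat) (A : 'M[R[i]]_n) (r : 'cV[R[i]]_n)
    (j : nat) : {vspace 'cV[R[i]]_n} :=
  <<[seq A ^+ i *m r | i <- iota 0 j]>>%VS.

Definition residual (R : realType) (n : nat) (A : 'M[R[i]]_n)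
    (b x : 'cV[R[i]]_n) : 'cV[R[i]]_n :=
  b - A *m x.

Definition gmres_cycle (R : realType) (n : nat) (A : 'M[R[i]]_n)
    (b : 'cV[R[i]]_n) (m : nat) (x x' : 'cV[R[i]]_n) : Prop :=
  x' - x \in krylov A (residual A b x) m /\
  forall y : 'cV[R[i]]_n, y - x \in krylov A (residual A b x) m ->
    enorm (residual A b x') <= enorm (residual A b y).

(* x k is the approximation after k cycles of GMRES(m).  This is a relation
   since, for singular A, the minimiser of a cycle need not be unique (its
   residual is). *)
Definition gmres (R : realType) (n : nat) (A : 'M[R[i]]_n)
    (b : 'cV[R[i]]_n) (m : nat) (x0 : 'cV[R[i]]_n)
    (x : nat -> 'cV[R[i]]_n) : Prop :=
  x 0%N = x0 /\ forall k : nat, gmres_cycle A b m (x k) (x k.+1).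

(* Main.v *)
Require Import Defs.
From HB Require Import structures.
From mathcomp Require Import all_boot all_order all_algebra zify.
From mathcomp Require Import complex reals boolp.

(** Restarted GMRES is governed here by polynomials.  Give C^n the model
    [K[X] / (p)] with [p = \prod_i (X - lambda_i)], let [A] be multiplication
    by [X] and let the initial residual be the class of [1].  One cycle then
    multiplies the residual by a polynomial of degree at most [m] with value 1
    at 0, and the aim is that cycle [k] multiplies it by [1 - c_k X^m].  So the
    residuals are the classes of [R_k = \prod_(i < k) (1 - c_i X^m)].

    The only thing left to choose is the inner product on the model, that is,
    which polynomial basis is declared orthonormal (lemma [exists_cyclic_model]
    turns any basis of polynomials of degree [< n] into the standard basis).
    Let [s] be the number of cycles in which the profile [f] strictly decreases;
    [s m < n].  Declare orthonormal
      [E_(k m + j) = X^(j+1) R_k]      for [k < s] and [j < m],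
      [E_(s m + j) = X^j R_s / f(s)]   for [s m + j < n].
    The vectors of block [k] are the Krylov images [A r_k, ..., A^m r_k].
    Telescoping [R_k = R_(k+1) + c_k X^m R_k] gives
      [r_k = \sum_(k <= l < s) c_l E_(l m + m - 1) + f(s) E_(s m)],
    so [r_(k+1) = r_k - c_k A^m r_k] is orthogonal to those images: it is the
    residual of cycle [k], and [|r_k|^2 = |r_(k+1)|^2 + c_k^2].  The choice
    [c_k^2 = f(k)^2 - f(k+1)^2] yields [|r_k| = f(k)].  After cycle [s] the
    Krylov images of [r_s] are multiples of [E_(s m + 1), ..., E_(s m + m)],
    all orthogonal to [r_s], so the residual stagnates; the room for these [m]
    vectors exists because a constant phase means [s < q], so that
    [(s + 1) m <= q m < n].

    The polynomials [E_i] form a basis even though their degrees are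
    [1, ..., s m, s m, ..., n - 1]: by the telescoping identity their span also
    contains [R_0 = 1], which supplies the missing degree.
    The argument lives in degrees below [n], where [p] is not seen: the spectrum
    is therefore arbitrary.  A cycle has at most one minimal residual, by
    Pythagoras, so every run of the method follows the sequence [r_k]. *)

Set Implicit Arguments.
Unset Strict Implicit.
Unset Printing Implicit Defensive.

Import Order.TTheory GRing.Theory Num.Theory.

Local Open Scope ring_scope.

(** * Matrices acting as multiplication by X in a prescribed polynomial basis *)

Lemma char_poly_trmx (R : comNzRingType) n (A : 'M[R]_n) :
  char_poly A^T = char_poly A.
Proof.
rewrite /char_poly -[RHS]det_tr; congr (\det _).
by apply/matrixP => i j; rewrite !mxE eq_sym.
Qed.

Lemma char_poly_similar (F : fieldType) n (P A B : 'M[F]_n) :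
  P \in unitmx -> P *m A = B *m P -> char_poly A = char_poly B.
Proof.
move=> uP PA_BP; pose Q := map_mx polyC P.
have: Q *m char_poly_mx A = char_poly_mx B *m Q.
  rewrite /char_poly_mx mulmxBr mulmxBl -!map_mxM PA_BP.
  by rewrite scalar_mxC.
move/(congr1 determinant); rewrite !det_mulmx [RHS]mulrC.
apply: mulfI; rewrite det_map_mx polyC_eq0.
by move: uP; rewrite unitmxE unitfE.
Qed.

(** Below degree [n - 1] no reduction modulo [p] takes place, so the companion
    matrix of [p] acts on coefficient rows as a plain shift. *)
Lemma exists_mulX_matrix (F : fieldType) n (p : {poly F}) :
    p \is monic -> size p = n.+1 ->
  exists2 C : 'M[F]_n, char_poly C = p &
    forall g : {poly F}, (size g < n)%N ->
      poly_rV g *m C = poly_rV ('X * g).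
Proof.
move=> p_monic size_p; have En : n = (size p).-1 by rewrite size_p.
move: size_p => _; subst n; exists (companionmx p).
  exact: companionmxK.
move=> g size_g; apply/rowP => j; rewrite !mxE coefXM.
(* The last row of the companion matrix, the only one that knows [p], meets the
   vanishing coefficient of degree [n - 1] of [g]. *)
have term (i : 'I_(size p).-1) :
    poly_rV g 0 i * companionmx p i j = (i.+1 == j)%:R * g`_i.
  rewrite !mxE; case: eqP => [Ei | _]; last by rewrite mulrC.
  suff -> : g`_i = 0 by rewrite mul0r mulr0.
  by apply: nth_default; rewrite Ei -ltnS prednK // (leq_trans _ size_g).
under eq_bigr do rewrite term.
case: j term => -[|j] j_lt _ /=; first by rewrite big1 // => i _; rewrite mul0r.
rewrite (bigD1 (Ordinal (ltnW j_lt))) //= eqxx mul1r big1 ?addr0 // => i.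
by rewrite -val_eqE /= eqSS => /negPf->; rewrite mul0r.
Qed.

(** Division by the leading terms of the [G i] reduces every polynomial of
    degree [< n] to 0, so the rows of [M] span everything. *)
Lemma graded_span_unitmx (F : fieldType) n (M : 'M[F]_n) (G : nat -> {poly F}) :
    (forall i, (i < n)%N -> size (G i) = i.+1) ->
    (forall i, (i < n)%N -> (poly_rV (G i) <= M)%MS) ->
  M \in unitmx.
Proof.
move=> size_G sub_G.
have sub_poly d : (d <= n)%N -> forall g : {poly F},
    (size g <= d)%N -> (poly_rV g <= M)%MS.
  elim: d => [|d IHd] d_le g size_g.
    by move: size_g; rewrite leqn0 size_poly_eq0 => /eqP->; rewrite linear0 sub0mx.
  pose a := g`_d / (G d)`_d.
  have Gd_neq0 : (G d)`_d != 0.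
    have: lead_coef (G d) != 0 by rewrite lead_coef_eq0 -size_poly_eq0 size_G.
    by rewrite lead_coefE size_G.
  rewrite -[g](subrK (a *: G d)) linearD /= addmx_sub //; last first.
    by rewrite linearZ scalemx_sub ?sub_G.
  apply: IHd; first exact: ltnW.
  apply/leq_sizeP => j; rewrite leq_eqVlt => /orP[/eqP<- | lt_dj].
    by rewrite coefB coefZ divfK ?subrr.
  rewrite coefB coefZ !nth_default ?mulr0 ?subrr ?size_G //.
  exact: leq_trans size_g _.
rewrite -row_full_unit -sub1mx; apply/row_subP => i.
have -> : row i 1%:M = poly_rV 'X^i :> 'rV[F]_n.
  by apply/rowP => j; rewrite !mxE coefXn eq_sym.
by apply: (sub_poly n) => //; rewrite size_polyXn.
Qed.

(** Any family [E] of [n] polynomials whose span contains a graded family [G] is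
    a basis of the polynomials of degree [< n]; expressing multiplication by [X]
    modulo [p] in that basis makes [E] the standard basis of column vectors.
    [Phi] is the coordinate map; it truncates polynomials of degree [>= n], so
    only its values below that degree are meaningful. *)
Lemma exists_cyclic_model (F : fieldType) n (p : {poly F})
    (E G : nat -> {poly F}) :
    p \is monic -> size p = n.+1 ->
    (forall i, (i < n)%N -> size (G i) = i.+1) ->
    (forall (V : {pred {poly F}}), GRing.submod_closed V ->
       (forall i, (i < n)%N -> E i \in V) ->
       forall i, (i < n)%N -> G i \in V) ->
    (forall i, (i < n)%N -> size (E i) <= n)%N ->
  exists (A : 'M[F]_n) (Phi : {linear {poly F} -> 'cV[F]_n}),
    [/\ char_poly A = p,
        forall g : {poly F}, (size g < n)%N -> A *m Phi g = Phi ('X * g) &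
        forall i : 'I_n, Phi (E i) = delta_mx i 0].
Proof.
move=> p_monic size_p size_G span_G size_E.
have [C charC mulC] := exists_mulX_matrix p_monic size_p.
pose M : 'M[F]_n := \matrix_(i < n) poly_rV (E i).
have row_M (i : 'I_n) : poly_rV (E i) = row i M by rewrite rowK.
have uM : M \in unitmx.
  apply: (@graded_span_unitmx _ _ _ G) => //.
  apply: (span_G [pred g | (poly_rV g <= M)%MS]).
    split; first by rewrite inE linear0 sub0mx.
    move=> a u v; rewrite !inE => uM vM.
    by rewrite linearD linearZ addmx_sub ?scalemx_sub.
  by move=> i i_lt; rewrite inE (row_M (Ordinal i_lt)) row_sub.
pose Phi : {linear {poly F} -> 'cV[F]_n} := trmx \o mulmxr (invmx M) \o poly_rV.
exists ((M *m C *m invmx M)^T), Phi; split.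
- rewrite char_poly_trmx -charC; apply/esym/(char_poly_similar uM).
  by rewrite -[RHS]mulmxA mulVmx ?mulmx1.
- move=> g size_g; rewrite /= -trmx_mul; congr trmx.
  by rewrite !mulmxA mulmxKV // mulC.
move=> i; rewrite /= row_M -row_mul mulmxV //.
by apply/matrixP => j k; rewrite !mxE ord1 eqxx andbT eq_sym.
Qed.

(** * Hermitian geometry and orthogonal projection *)

(** The Hermitian product is conjugate-linear on the left, so that [hdot u] is a
    linear form.  The codomain [C^o] of the linear structure is [C] as a module
    over itself. *)
Definition hdot (C : numClosedFieldType) n (u v : 'cV[C]_n) : C :=
  \sum_(i < n) (u i 0)^* * v i 0.

Section HermitianDot.
Variables (C : numClosedFieldType) (n : nat).
Implicit Types u v w : 'cV[C]_n.

Lemma hdot_is_linear u : linear (hdot u : 'cV[C]_n -> C^o).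
Proof.
move=> a v w; rewrite /hdot scaler_sumr -big_split; apply: eq_bigr => i _ /=.
by rewrite !mxE mulrDr mulrCA.
Qed.

HB.instance Definition _ u :=
  GRing.isLinear.Build C 'cV[C]_n C^o _ (hdot u) (hdot_is_linear u).

Lemma hdotC u v : hdot v u = (hdot u v)^*.
Proof.
by rewrite rmorph_sum; apply: eq_bigr => i _; rewrite rmorphM /= conjCK mulrC.
Qed.

Lemma hdotDl u v w : hdot (u + v) w = hdot u w + hdot v w.
Proof. by rewrite hdotC linearD rmorphD /= -!hdotC. Qed.

Lemma hdotZl a u v : hdot (a *: u) v = a^* * hdot u v.
Proof. by rewrite hdotC linearZ rmorphM /= -hdotC. Qed.

Lemma hdotZr a u v : hdot u (a *: v) = a * hdot u v.
Proof. exact: linearZ. Qed.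

Lemma hdot0l u : hdot 0 u = 0.
Proof. by rewrite hdotC linear0 rmorph0. Qed.

Lemma hdot_ge0 u : 0 <= hdot u u.
Proof. by apply: sumr_ge0 => i _; rewrite mulrC mul_conjC_ge0. Qed.

Lemma hdot_eq0 u : hdot u u = 0 -> u = 0.
Proof.
move/eqP; rewrite psumr_eq0; last by move=> i _; rewrite mulrC mul_conjC_ge0.
move/allP=> u0; apply/matrixP => i j; rewrite ord1 mxE.
have := u0 i (mem_index_enum i).
by rewrite implyTb mulrC mul_conjC_eq0 => /eqP.
Qed.

Lemma hdot_pythagoras u v : hdot u v = 0 ->
  hdot (u + v) (u + v) = hdot u u + hdot v v.
Proof.
move=> uv0; have vu0 : hdot v u = 0 by rewrite hdotC uv0 rmorph0.
by rewrite hdotDl !linearD /= uv0 vu0 addr0 add0r.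
Qed.

Lemma hdot_delta i v : hdot (delta_mx i 0) v = v i 0.
Proof.
rewrite /hdot (bigD1 i) //= !mxE !eqxx conjC1 mul1r big1 ?addr0 // => j ne_ji.
by rewrite !mxE (negPf ne_ji) conjC0 mul0r.
Qed.

(** Gram-Schmidt, one generator [a] at a time: the component [a'] of [a]
    orthogonal to the previous span corrects the previous projection. *)
Lemma exists_orthogonal_projection (W : seq 'cV[C]_n) r :
  exists2 u, u \in <<W>>%VS & forall w, w \in <<W>>%VS -> hdot w (r - u) = 0.
Proof.
elim: W r => [|a W IHW] r.
  exists 0; first exact: mem0v.
  by move=> w; rewrite span_nil memv0 => /eqP->; rewrite hdot0l.
have [ua uaW orth_a] := IHW a; have [ur urW orth_r] := IHW r.
pose a' := a - ua; pose t := hdot a' (r - ur) / hdot a' a'.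
have sW x : x \in <<W>>%VS -> x \in <<a :: W>>%VS.
  by rewrite span_cons; apply: subvP; apply: addvSr.
have aW : a' \in <<a :: W>>%VS.
  by rewrite rpredB ?(sW ua) // memv_span ?mem_head.
exists (ur + t *: a'); first by rewrite rpredD ?rpredZ ?(sW ur).
move=> w; rewrite span_cons => /memv_addP[_ /vlineP[c ->] [v vW ->]].
have -> : c *: a + v = c *: a' + (c *: ua + v).
  by rewrite addrA -scalerDr subrK.
have split_r x : hdot x (r - (ur + t *: a')) = hdot x (r - ur) - t * hdot x a'.
  by rewrite opprD addrA linearB linearZ.
have v'W : c *: ua + v \in <<W>>%VS by rewrite rpredD ?rpredZ.
rewrite hdotDl hdotZl !split_r (orth_r _ v'W) (orth_a _ v'W) mulr0 subr0 addr0.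
have [a'0|a'_neq0] := eqVneq (hdot a' a') 0.
  by rewrite (hdot_eq0 a'0) !hdot0l mulr0 subr0 mulr0.
by rewrite divfK // subrr mulr0.
Qed.

End HermitianDot.

Lemma enorm_sqr (R : realType) n (v : 'cV[R[i]]_n) :
  real_complex R (enorm v ^+ 2) = hdot v v.
Proof.
rewrite /enorm sqr_sqrtr; last by apply: sumr_ge0 => i _; apply: sqr_ge0.
rewrite rmorph_sum; apply: eq_bigr => i _.
by rewrite -normCKC -[in RHS](RRe_real (normr_real _)) -rmorphXn.
Qed.

Lemma enorm_ge0 (R : realType) n (v : 'cV[R[i]]_n) : 0 <= enorm v.
Proof. exact: sqrtr_ge0. Qed.

Lemma ler_enorm (R : realType) n (u v : 'cV[R[i]]_n) :
  (enorm u <= enorm v) = (hdot u u <= hdot v v).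
Proof. by rewrite -!enorm_sqr lecR ler_sqr ?nnegrE ?enorm_ge0. Qed.

(** * Cycles of restarted GMRES *)

(** [r'] is the residual after a cycle from [r]: by the projection theorem,
    minimality of the norm over [r - A K_m(A, r)] amounts to orthogonality to
    [A K_m(A, r)]. *)
Definition optimal_residual (R : realType) n (A : 'M[R[i]]_n) m
    (r r' : 'cV[R[i]]_n) : Prop :=
  exists2 z, z \in krylov A r m &
    r' = r - A *m z /\ forall y, y \in krylov A r m -> hdot (A *m y) r' = 0.

Lemma krylov_orthogonal (R : realType) n (A : 'M[R[i]]_n) m
    (r v : 'cV[R[i]]_n) :
    (forall j, (j < m)%N -> hdot (A ^+ j.+1 *m r) v = 0) ->
  forall y, y \in krylov A r m -> hdot (A *m y) v = 0.
Proof.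
move=> orth y /(@coord_span _ _ _ (in_tuple _)) ->.
rewrite mulmx_sumr hdotC linear_sum /= big1 ?rmorph0 // => j _.
have j_lt : (j < m)%N by rewrite (leq_trans (ltn_ord j)) // size_map size_iota.
rewrite -scalemxAr hdotZr (nth_map 0%N) ?size_iota // nth_iota //.
by rewrite mulmxA -[A *m _]/(A * _) -exprS hdotC orth // rmorph0 mulr0.
Qed.

Section Cycle.
Variables (R : realType) (n : nat) (A : 'M[R[i]]_n) (b : 'cV[R[i]]_n) (m : nat).
Implicit Types x y z : 'cV[R[i]]_n.

Lemma residual_step x z : residual A b (x + z) = residual A b x - A *m z.
Proof. by rewrite /residual mulmxDr opprD addrA. Qed.

(** Every competitor [x + w] of a cycle differs from the optimal one by a vector
    of [A K_m], which is orthogonal to the optimal residual. *)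
Lemma residual_pythagoras x z w r' :
    let r := residual A b x in
    z \in krylov A r m -> w \in krylov A r m -> r' = r - A *m z ->
    (forall y, y \in krylov A r m -> hdot (A *m y) r' = 0) ->
  hdot (residual A b (x + w)) (residual A b (x + w)) =
    hdot (A *m (z - w)) (A *m (z - w)) + hdot r' r'.
Proof.
move=> r zK wK Er' orth.
rewrite -hdot_pythagoras ?orth ?rpredB // residual_step -/r Er'.
by congr hdot; rewrite mulmxBr [RHS]addrC addrA subrK.
Qed.

Lemma optimal_residual_gmres_cycle x r' :
  optimal_residual A m (residual A b x) r' -> exists x', gmres_cycle A b m x x'.
Proof.
case=> z zK [Er' orth]; exists (x + z); split; first by rewrite addrC addKr.
move=> y yK; rewrite ler_enorm.
have -> : y = x + (y - x) by rewrite addrC subrK.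
rewrite (residual_pythagoras zK yK Er' orth) residual_step -Er'.
by rewrite lerDr hdot_ge0.
Qed.

(** The minimiser itself need not be unique, its residual is: the Pythagorean
    excess of any other competitor must vanish. *)
Lemma gmres_cycle_residual x x' r' :
    optimal_residual A m (residual A b x) r' -> gmres_cycle A b m x x' ->
  residual A b x' = r'.
Proof.
case=> z zK [Er' orth] [x'K min_x'].
have Ex' : x' = x + (x' - x) by rewrite addrC subrK.
have := min_x' (x + z); rewrite addrAC subrr add0r => /(_ zK).
rewrite ler_enorm {1 2}Ex' (residual_pythagoras zK x'K Er' orth).
rewrite residual_step -Er' gerDr => le0.
apply/eqP; rewrite -subr_eq0 Ex' residual_step Er'.
rewrite opprB addrACA [- _ + _]addrC addrACA subrr add0r -mulmxBr.
by apply/eqP/hdot_eq0/le_anti; rewrite hdot_ge0 le0.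
Qed.

Lemma exists_optimal_residual r : exists r', optimal_residual A m r r'.
Proof.
pose f := linfun (mulmx A : 'cV_n -> 'cV_n).
have [u] := exists_orthogonal_projection
  [seq f (A ^+ i *m r) | i <- iota 0 m] r.
rewrite map_comp -limg_span => /memv_imgP[z zK ->] orth.
exists (r - A *m z), z => //; split=> // y yK.
by have:= orth (f y) (memv_img f yK); rewrite !lfunE.
Qed.

Lemma exists_gmres x0 : exists xs, gmres A b m x0 xs.
Proof.
have [x | next nextP] := @choice _ _ (gmres_cycle A b m).
  have [r' opt_r'] := exists_optimal_residual (residual A b x).
  exact: optimal_residual_gmres_cycle opt_r'.
by exists (fun k => iter k next x0); split=> // k; apply: nextP.
Qed.

End Cycle.

(** * The residual polynomials *)

Section ResidualPolynomials.
Variables (F : fieldType) (m : nat) (c : nat -> F).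
Hypotheses (m_gt0 : (0 < m)%N) (c_neq0 : forall k, c k != 0).

Definition respoly k : {poly F} := \prod_(i < k) (1 - c i *: 'X^m).

Lemma respolyS k : respoly k = respoly k.+1 + c k *: ('X^m * respoly k).
Proof.
rewrite /respoly big_ord_recr /= mulrBr mulr1 -scalerAr ['X^m * _]mulrC.
by rewrite subrK.
Qed.

Lemma size_respoly k : size (respoly k) = (k * m).+1.
Proof.
have size_factor i : size (1 - c i *: 'X^m) = m.+1.
  rewrite addrC size_polyDl size_polyN size_scale ?size_polyXn ?c_neq0 //.
  by rewrite size_poly1.
elim: k => [|k IHk]; first by rewrite /respoly big_ord0 size_poly1.
rewrite /respoly big_ord_recr /= -/(respoly k) size_mul ?IHk ?size_factor.
- by rewrite mulSn addnS addSn /= addnC.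
- by rewrite -size_poly_eq0 IHk.
- by rewrite -size_poly_eq0 size_factor.
Qed.

Lemma size_Xn_respoly j k : size ('X^j * respoly k) = (j + k * m).+1.
Proof.
by rewrite mulrC size_mulXn -?size_poly_eq0 size_respoly // addnS.
Qed.

(** The basis [E] consists of the blocks [X R_k, ..., X^m R_k] for [k < s],
    followed by [R_s / d, X R_s / d, ...]; the vectors [r k] are the classes of
    the [R_k].  In the conclusion [d] becomes the norm of the last residual and
    [c k] the length removed by cycle [k]. *)
Lemma exists_block_krylov_matrix n s (d : F) (p : {poly F}) :
    (s * m < n)%N -> d != 0 -> p \is monic -> size p = n.+1 ->
  exists (A : 'M[F]_n) (r : nat -> 'cV[F]_n),
    [/\ char_poly A = p,
        forall k j (i : 'I_n), (k < s)%N -> (j < m)%N -> i = (k * m + j)%N :> nat ->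
          A ^+ j.+1 *m r k = delta_mx i 0,
        forall j (i : 'I_n), i = (s * m + j)%N :> nat ->
          A ^+ j *m r s = d *: delta_mx i 0 &
        forall k, (k < s)%N -> r k = r k.+1 + c k *: (A ^+ m *m r k)].
Proof.
move=> lt_sm_n d_neq0 p_monic size_p.
pose E i := if (i < s * m)%N then 'X^((i %% m).+1) * respoly (i %/ m)
            else d^-1 *: ('X^(i - s * m) * respoly s).
(* If [s > 0], then [E] has two members of degree [s m] and none of degree 0;
   [G] repairs this by putting 1 first and dropping [E (s m - 1)]. *)
pose G i := if (i < s * m)%N then if i is i'.+1 then E i' else 1 else E i.
have E_lt k j : (k < s)%N -> (j < m)%N -> E (k * m + j)%N = 'X^(j.+1) * respoly k.
  move=> lt_ks lt_jm; rewrite /E ifT; last by nia.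
  by rewrite modnMDl modn_small // divnMDl // divn_small // addn0.
have E_ge j : E (s * m + j)%N = d^-1 *: ('X^j * respoly s).
  by rewrite /E ltnNge leq_addr addKn.
have size_E i : size (E i) = if (i < s * m)%N then i.+2 else i.+1.
  rewrite /E; case: ltnP => [_ | le_smi].
    by rewrite size_Xn_respoly addSn addnC -divn_eq.
  by rewrite size_scale ?invr_eq0 // size_Xn_respoly subnK.
have [|||||A [Phi [charA mulA PhiE]]] := @exists_cyclic_model F n p E G.
- exact: p_monic.
- exact: size_p.
- move=> i _; rewrite /G; case: (ltnP i) => [|le_smi]; last first.
    by rewrite size_E ltnNge le_smi.
  by case: i => [|i] lt_i; rewrite ?size_poly1 // size_E ltnW.
- move=> V [V0 Vlin] EV.
  have VD u v : u \in V -> v \in V -> u + v \in V.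
    by move=> uV vV; rewrite -[u]scale1r Vlin.
  have VZ a u : u \in V -> a *: u \in V.
    by move=> uV; rewrite -[_ *: u]addr0 Vlin.
  (* Telescoping downwards from [R_s] puts every [R_k], hence 1, in the span. *)
  have rV k : (k <= s)%N -> respoly (s - k) \in V.
    elim: k => [_ | k IHk lt_ks].
      have := EV (s * m + 0)%N; rewrite addn0 => /(_ lt_sm_n).
      move/(VZ d); rewrite -[X in E X]addn0 E_ge expr0 mul1r scalerA divff //.
      by rewrite scale1r subn0.
    rewrite respolyS; have Es : (s - k.+1).+1 = (s - k)%N by lia.
    apply: VD; first by rewrite Es IHk // ltnW.
    apply: VZ; rewrite -[X in 'X^X](prednK m_gt0) -E_lt; [|lia|lia].
    by apply: EV; nia.
  move=> i lt_in; rewrite /G; case: ifP => _; last exact: EV.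
  case: i lt_in => [_|i lt_in]; last by apply: EV; exact: ltnW.
  by have := rV s (leqnn s); rewrite subnn /respoly big_ord0.
- by move=> i lt_in; rewrite size_E; case: ltnP => // lt_i; lia.
have mulAX j (g : {poly F}) : (size g + j <= n)%N ->
    A ^+ j *m Phi g = Phi ('X^j * g).
  elim: j => [|j IHj] le_n; first by rewrite !expr0 mul1r [1 *m _]mul1mx.
  rewrite exprS -[A * _]/(A *m _) -mulmxA IHj; last by lia.
  rewrite mulA ?mulrA -?exprS //.
  have [->|g_neq0] := eqVneq g 0; first by rewrite mulr0 size_poly0; lia.
  by rewrite mulrC size_mulXn //; lia.
exists A, (Phi \o respoly); split=> // [k j i lt_ks lt_jm Ei | j i Ei | k lt_ks] /=.
- rewrite mulAX ?size_respoly; last by nia.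
  by rewrite -E_lt // -Ei PhiE.
- rewrite mulAX ?size_respoly; last by have := ltn_ord i; lia.
  by rewrite -PhiE Ei E_ge linearZ scalerA divff // scale1r.
rewrite mulAX ?size_respoly; last by nia.
by rewrite {1}respolyS linearD linearZ.
Qed.

End ResidualPolynomials.

(** * Prescribed residual norms *)

(** Both shapes of the profile are a strict decrease up to some [s] followed by a
    constant phase, reduced to [s] when [s = q]. *)
Lemma strict_phase_of_profile (R : realType) (q : nat) (f : nat -> R) :
    (forall k : nat, (k < q)%N -> f k.+1 < f k) \/
    (exists s : nat,
      [/\ (s < q)%N,
          forall k : nat, (k < s)%N -> f k.+1 < f k &
          forall k : nat, (s <= k <= q)%N -> f k = f s]) ->
  exists s, [/\ (s <= q)%N, forall k, (k < s)%N -> f k.+1 < f k &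
                forall k, (s <= k <= q)%N -> f k = f s].
Proof.
case=> [f_decr | [s [lt_sq f_decr f_const]]]; last by exists s; split=> //; lia.
by exists q; split=> // k; rewrite -eqn_leq => /eqP->.
Qed.

(** The constants of [exists_block_krylov_matrix] are [c k = gap k] and
    [d = f s]; from [s] on, the value 1 merely keeps [c] nonzero. *)
Lemma exists_prescribed_residuals (R : realType) n m s (f : nat -> R)
    (p : {poly R[i]}) :
    (0 < m)%N -> (s * m < n)%N ->
    (forall k, (k <= s)%N -> 0 < f k) -> (forall k, (k < s)%N -> f k.+1 < f k) ->
    p \is monic -> size p = n.+1 ->
  exists (A : 'M[R[i]]_n) (r : nat -> 'cV[R[i]]_n),
    [/\ char_poly A = p,
        forall k, (k <= s)%N -> enorm (r k) = f k,
        forall k, (k < s)%N -> optimal_residual A m (r k) (r k.+1) &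
        (s.+1 * m < n)%N -> optimal_residual A m (r s) (r s)].
Proof.
move=> m_gt0 lt_sm_n f_gt0 f_lt p_monic size_p.
pose gap k := Num.sqrt (f k ^+ 2 - f k.+1 ^+ 2).
pose c k : R[i] := if (k < s)%N then real_complex R (gap k) else 1.
have sqr_lt k : (k < s)%N -> f k.+1 ^+ 2 < f k ^+ 2.
  by move=> lt_ks; rewrite ltr_sqr ?nnegrE ?ltW ?f_lt ?f_gt0 //; lia.
have c_neq0 k : c k != 0.
  rewrite /c; case: ifP => [lt_ks | _]; last exact: oner_neq0.
  by rewrite fmorph_eq0 gt_eqF // sqrtr_gt0 subr_gt0 sqr_lt.
have d_neq0 : real_complex R (f s) != 0 by rewrite fmorph_eq0 gt_eqF ?f_gt0.
have [A [r [charA krylov_lt krylov_ge r_step]]] :=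
  exists_block_krylov_matrix m_gt0 c_neq0 lt_sm_n d_neq0 p_monic size_p.
have r_s : r s = real_complex R (f s) *: delta_mx (Ordinal lt_sm_n) 0.
  by rewrite -(krylov_ge 0) ?addn0 // expr0 [1 *m _]mul1mx.
(* Downward induction on [k = s - j]: the vector that cycle [k] removes has
   index [k m + m - 1], below the support of [r k.+1]. *)
have r_coord k : (k <= s)%N ->
    (forall i : 'I_n, (i < k * m)%N -> r k i 0 = 0) /\
    hdot (r k) (r k) = real_complex R (f k ^+ 2).
  move=> le_ks; rewrite -(subKn le_ks).
  elim: (s - k)%N (leq_subr k s) => [|j IHj] lt_js.
    rewrite subn0 r_s; split=> [i lt_i|].
      by rewrite !mxE -val_eqE /= (ltn_eqF lt_i) mulr0.
    rewrite hdotZl hdotZr hdot_delta !mxE !eqxx mulr1.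
    by rewrite -[Num.conj _]/(conjc _) conjc_real -rmorphM -expr2.
  have {IHj} [coord0 norm_r] := IHj (ltnW lt_js).
  set l := (s - j.+1)%N in coord0 norm_r *.
  have El : (s - j)%N = l.+1 by lia.
  have lt_ls : (l < s)%N by lia.
  rewrite El in coord0 norm_r.
  have i_lt : (l * m + m.-1 < n)%N by nia.
  rewrite r_step //.
  have := krylov_lt l m.-1 (Ordinal i_lt) lt_ls; rewrite prednK // => -> //.
  split=> [i lt_i|].
    rewrite !mxE coord0; last by nia.
    by rewrite -val_eqE /= ltn_eqF ?mulr0 ?addr0 //; lia.
  rewrite [_ + _]addrC hdot_pythagoras; last first.
    by rewrite hdotZl hdot_delta coord0 ?mulr0 //=; nia.
  rewrite norm_r hdotZl hdotZr hdot_delta !mxE !eqxx mulr1 /c lt_ls.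
  rewrite -[Num.conj _]/(conjc _) conjc_real -[_ * _]rmorphM -rmorphD -expr2.
  by rewrite sqr_sqrtr ?subr_ge0 ?ltW ?sqr_lt // subrK.
have norm_r k : (k <= s)%N -> enorm (r k) = f k.
  move=> le_ks; have [_ ] := r_coord k le_ks.
  rewrite -enorm_sqr => /complexI /eqP.
  have fk_gt0 : 0 < f k by rewrite f_gt0 // (leq_trans le_ks).
  by rewrite eqrXn2 ?enorm_ge0 ?(ltW fk_gt0) // => /eqP.
exists A, r; split=> // [k lt_ks | lt_s1m_n].
  have r_next : r k.+1 = r k - A *m (c k *: (A ^+ m.-1 *m r k)).
    rewrite -scalemxAr mulmxA -[A *m _]/(A * _) -exprS prednK //.
    by rewrite {1}(r_step k lt_ks) addrK.
  exists (c k *: (A ^+ m.-1 *m r k)).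
    rewrite rpredZ // memv_span //; apply/mapP; exists m.-1 => //.
    by rewrite mem_iota; lia.
  split=> //; apply: krylov_orthogonal => j lt_jm.
  have i_lt : (k * m + j < n)%N by nia.
  rewrite (krylov_lt _ _ (Ordinal i_lt)) // hdot_delta.
  by apply: (r_coord _ lt_ks).1; rewrite /=; nia.
exists 0; first exact: mem0v.
split; first by rewrite mulmx0 subr0.
apply: krylov_orthogonal => j lt_jm.
have i_lt : (s * m + j.+1 < n)%N by nia.
rewrite (krylov_ge _ (Ordinal i_lt)) // hdotZl hdot_delta r_s.
by rewrite !mxE -val_eqE /= gtn_eqF ?mulr0 //; lia.
Qed.

Theorem theorem3 (R : realType) (n m q : nat)
    (n_gt0 : (0 < n)%N) (m_gt0 : (0 < m)%N) (q_gt0 : (0 < q)%N)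
    (lt_mn : (m < n)%N) (lt_q_nm : q%:R < n%:R / m%:R :> R)
    (f : nat -> R)
    (f_gt0 : forall k : nat, (k <= q)%N -> 0 < f k)
    (f_decr :
      (forall k : nat, (k < q)%N -> f k.+1 < f k) \/
      (exists s : nat,
        [/\ (s < q)%N,
            forall k : nat, (k < s)%N -> f k.+1 < f k &
            forall k : nat, (s <= k <= q)%N -> f k = f s]))
    (lambda : 'I_n -> R[i]) (lambda_neq0 : forall i : 'I_n, lambda i != 0) :
  exists (A : 'M[R[i]]_n) (r0 : 'cV[R[i]]_n),
    [/\ char_poly A = \prod_(i < n) ('X - (lambda i)%:P),
        enorm r0 = f 0%N &
        forall b x0 : 'cV[R[i]]_n, residual A b x0 = r0 ->
          (exists x : nat -> 'cV[R[i]]_n, gmres A b m x0 x) /\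
          (forall x : nat -> 'cV[R[i]]_n, gmres A b m x0 x ->
             forall k : nat, (1 <= k <= q)%N ->
               enorm (residual A b (x k)) = f k)].
Proof.
have lt_qm_n : (q * m < n)%N.
  by move: lt_q_nm; rewrite ltr_pdivlMr ?ltr0n // -natrM ltr_nat.
have [s [le_sq f_lt f_const]] := strict_phase_of_profile f_decr.
have lt_sm_n : (s * m < n)%N by nia.
have f_gt0' k : (k <= s)%N -> 0 < f k.
  by move=> le_ks; rewrite f_gt0 // (leq_trans le_ks).
have p_monic : \prod_(i < n) ('X - (lambda i)%:P) \is monic.
  by apply: monic_prod => i _; apply: monicXsubC.
have size_p : size (\prod_(i < n) ('X - (lambda i)%:P)) = n.+1.
  by rewrite size_prod_XsubC /index_enum -enumT size_enum_ord.
have [A [r [charA norm_r r_decr r_stagn]]] :=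
  exists_prescribed_residuals m_gt0 lt_sm_n f_gt0' f_lt p_monic size_p.
exists A, (r 0); split=> //; first exact: norm_r.
move=> b x0 r0E; split; first exact: exists_gmres.
move=> x [x_0 x_cycle] k /andP[_ le_kq].
have resE : residual A b (x k) = r (minn k s).
  elim: k le_kq => [_ | k IHk lt_kq]; first by rewrite x_0 r0E min0n.
  apply: gmres_cycle_residual (x_cycle k); rewrite IHk; last exact: ltnW.
  have [lt_ks | le_sk] := ltnP k s.
    by rewrite (minn_idPl lt_ks); apply: r_decr.
  rewrite (minn_idPr (leqW le_sk)); apply: r_stagn.
  (* A stagnating cycle [k < q] forces [s < q], which leaves room for one more
     block of [m] basis vectors. *)
  nia.
rewrite resE norm_r ?geq_minr //; case: (leqP k s) => [// | lt_sk].
by rewrite f_const // (ltnW lt_sk).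
Qed.
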